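(* Let $f \in \mathbb{Z}[t,t^{-1}]$ be a monic reciprocal Laurent polynomial. Let $\mu \in \widehat{\mathbb{Z}}^\times$ and assume the equality of ideals $(f(t)) = (f(t^\mu))$ in $\widehat{\mathbb{Z}}[[\widehat{\mathbb{Z}}]]$. Then either $\mu = \pm 1$, or all roots of $f$ are roots of unity.
   Context: A Laurent polynomial $f\in\mathbb{Z}[t,t^{-1}]$ is reciprocal if $f(t) = t^N f(t^{-1})$ for some $N \in \mathbb{Z}$, and monic if its leading coefficient is $1$. A root of a Laurent polynomial $f$ in a field $K$ is a non-zero $\alpha\in K$ with $f(\alpha)=0$; here roots are taken in an algebraic closure of $\mathbb{Q}$. $\widehat{\mathbb{Z}}$ is the profinite completion of $\mathbb{Z}$, and $\widehat{\mathbb{Z}}[[\widehat{\mathbb{Z}}]] = \varprojlim_{m,n} (\mathbb{Z}/m)[\mathbb{Z}/n]$ is the completed group ring of the (additive) profinite group $\widehat{\mathbb{Z}}$ with coefficients in $\widehat{\mathbb{Z}}$. The group ring $\mathbb{Z}[\mathbb{Z}] \simeq \mathbb{Z}[t,t^{-1}]$ embeds in it, with $t$ corresponding to the group element $1\in\mathbb{Z}\subset\widehat{\mathbb{Z}}$; for $\nu\in\widehat{\mathbb{Z}}$, $t^\nu$ denotes the group element $\nu\in\widehat{\mathbb{Z}}$. For $f=\sum_k a_k t^k$, $f(t^\mu) = \sum_k a_k t^{k\mu}$. For an element $x$, $(x)$ denotes the principal ideal of $\widehat{\mathbb{Z}}[[\widehat{\mathbb{Z}}]]$ generated by $x$ (automatically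 closed, by compactness; called a continuous ideal). *)

(* Defs.v *)
From HB Require Import structures.
From mathcomp Require Import all_boot all_order all_algebra all_field.
From mathcomp Require Import finmap monalg.
From mathcomp Require Import boolp classical_sets.

Set Implicit Arguments.
Unset Strict Implicit.
Unset Printing Implicit Defensive.

Import Order.TTheory GRing.Theory Num.Theory.
Local Open Scope ring_scope.

(* The functoriality of the transition maps is not required: it plays no role
   in the definition of the limit, and holds in the two systems used below. *)
Record inv_system := InvSystem {
  idx : Type;
  idx0 : idx;
  ord : idx -> idx -> Prop;
  obj : idx -> comNzRingType;
  tr : forall i j, ord i j -> {rmorphism obj j -> obj i}
}.

Section InverseLimit.
Variable S : inv_system.

Definition invlim : Type :=
  {x : forall i : idx S, obj i | forall i j (h : ord i j), tr h (x j) = x i}.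

Definition proj (i : idx S) (x : invlim) : obj i := sval x i.

Lemma proj_tr i j (h : ord i j) (x : invlim) : tr h (proj j x) = proj i x.
Proof. exact: (svalP x). Qed.

Lemma invlimP (x y : invlim) : (forall i, proj i x = proj i y) -> x = y.
Proof.
case: x y => [x hx] [y hy] /= E.
have {}E : x = y by apply: functional_extensionality_dep => i; exact: E.
by case: y / E hy => hy; congr exist; exact: Prop_irrelevance.
Qed.

HB.instance Definition _ := gen_eqMixin invlim.
HB.instance Definition _ := gen_choiceMixin invlim.

Fact invlim_zero_subproof i j (h : @ord S i j) : tr h 0 = 0.
Proof. exact: rmorph0. Qed.
Definition invlim_zero : invlim := exist _ (fun=> 0) invlim_zero_subproof.

Fact invlim_one_subproof i j (h : @ord S i j) : tr h 1 = 1.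
Proof. exact: rmorph1. Qed.
Definition invlim_one : invlim := exist _ (fun=> 1) invlim_one_subproof.

Fact invlim_opp_subproof (x : invlim) i j (h : ord i j) :
  tr h (- proj j x) = - proj i x.
Proof. by rewrite rmorphN proj_tr. Qed.
Definition invlim_opp (x : invlim) : invlim :=
  exist _ (fun i => - proj i x) (@invlim_opp_subproof x).

Fact invlim_add_subproof (x y : invlim) i j (h : ord i j) :
  tr h (proj j x + proj j y) = proj i x + proj i y.
Proof. by rewrite rmorphD !proj_tr. Qed.
Definition invlim_add (x y : invlim) : invlim :=
  exist _ (fun i => proj i x + proj i y) (@invlim_add_subproof x y).

Fact invlim_mul_subproof (x y : invlim) i j (h : ord i j) :
  tr h (proj j x * proj j y) = proj i x * proj i y.
Proof. by rewrite rmorphM !proj_tr. Qed.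
Definition invlim_mul (x y : invlim) : invlim :=
  exist _ (fun i => proj i x * proj i y) (@invlim_mul_subproof x y).

Fact invlim_addA : associative invlim_add.
Proof. by move=> x y z; apply: invlimP => i; exact: addrA. Qed.
Fact invlim_addC : commutative invlim_add.
Proof. by move=> x y; apply: invlimP => i; exact: addrC. Qed.
Fact invlim_add0 : left_id invlim_zero invlim_add.
Proof. by move=> x; apply: invlimP => i; exact: add0r. Qed.
Fact invlim_addN : left_inverse invlim_zero invlim_opp invlim_add.
Proof. by move=> x; apply: invlimP => i; exact: addNr. Qed.

HB.instance Definition _ := GRing.isZmodule.Build invlim
  invlim_addA invlim_addC invlim_add0 invlim_addN.

Fact invlim_mulA : associative invlim_mul.
Proof. by move=> x y z; apply: invlimP => i; exact: mulrA. Qed.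
Fact invlim_mulC : commutative invlim_mul.
Proof. by move=> x y; apply: invlimP => i; exact: mulrC. Qed.
Fact invlim_mul1 : left_id invlim_one invlim_mul.
Proof. by move=> x; apply: invlimP => i; exact: mul1r. Qed.
Fact invlim_mulDl : left_distributive invlim_mul invlim_add.
Proof. by move=> x y z; apply: invlimP => i; exact: mulrDl. Qed.
Fact invlim_1neq0 : invlim_one != 0 :> invlim.
Proof.
apply/eqP => /(congr1 (proj (idx0 S))) E.
by have /eqP[] := oner_neq0 (obj (idx0 S)).
Qed.

HB.instance Definition _ := GRing.Zmodule_isComNzRing.Build invlim
  invlim_mulA invlim_mulC invlim_mul1 invlim_mulDl invlim_1neq0.

Definition invlim_unit : {pred invlim} := fun x => `[< exists y, y * x = 1 >].
Definition invlim_inv (x : invlim) : invlim :=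
  if pselect (exists y, y * x = 1) is left h then projT1 (cid h) else x.

Fact invlim_mulV : {in invlim_unit, left_inverse 1 invlim_inv *%R}.
Proof.
move=> x /asboolP hx; rewrite /invlim_inv.
by case: pselect => [h|//]; case: cid.
Qed.
Fact invlim_unitP (x y : invlim) : y * x = 1 -> invlim_unit x.
Proof. by move=> h; apply/asboolP; exists y. Qed.
Fact invlim_invN : {in [predC invlim_unit], invlim_inv =1 id}.
Proof.
move=> x /asboolPn hx; rewrite /invlim_inv.
by case: pselect.
Qed.

HB.instance Definition _ := GRing.ComNzRing_hasMulInverse.Build invlim
  invlim_mulV invlim_unitP invlim_invN.

End InverseLimit.

Section Reduction.
Variables m n : nat.
Hypothesis mn : (m.+2 %| n.+2)%N.

Definition Zred (_ : (m.+2 %| n.+2)%N) (x : 'Z_n.+2) : 'Z_m.+2 :=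
  (x : nat)%:R.

Fact Zred_natr k : Zred mn k%:R = k%:R.
Proof.
apply: val_inj.
by rewrite /Zred /= !val_Zp_nat //= modn_dvdm.
Qed.

Fact Zred_zmod_morphism : zmod_morphism (Zred mn).
Proof.
move=> x y; apply/eqP; rewrite -[x]natr_Zp -[y]natr_Zp.
rewrite eq_sym subr_eq !Zred_natr -[_ - _ in X in _ == X]natr_Zp Zred_natr.
rewrite -natrD -!Zred_natr; apply/eqP; congr Zred.
by rewrite natrD !natr_Zp subrK.
Qed.

Fact Zred_monoid_morphism : monoid_morphism (Zred mn).
Proof.
split=> [|x y]; first by rewrite -[1]/(1%:R) Zred_natr.
by rewrite -[x]natr_Zp -[y]natr_Zp -natrM !Zred_natr natrM.
Qed.

HB.instance Definition _ :=
  GRing.isZmodMorphism.Build 'Z_n.+2 'Z_m.+2 (Zred mn) Zred_zmod_morphism.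
HB.instance Definition _ :=
  GRing.isMonoidMorphism.Build 'Z_n.+2 'Z_m.+2 (Zred mn) Zred_monoid_morphism.

End Reduction.

(* The index [n] stands for the modulus [n.+2]: MathComp's rings are nontrivial
   and ['Z_0], ['Z_1] both denote Z/2. The moduli at least 2 are cofinal, so
   that leaving out the modulus 1 does not change the limits. *)
Definition Zhat_system := InvSystem 0
  (fun (m n : nat) (h : (m.+2 %| n.+2)%N) =>
   Zred h : {rmorphism 'Z_n.+2 -> 'Z_m.+2}).

Definition Zhat := invlim Zhat_system.
HB.instance Definition _ := GRing.ComUnitRing.on Zhat.

(* [u g] is the coefficient of the group element [g]; the multiplication is the
   convolution, not the pointwise product of [{ffun G -> R}]. *)
Definition grpring (R : comNzRingType) (G : finZmodType) : Type := {ffun G -> R}.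

Section GroupRing.
Variables (R : comNzRingType) (G : finZmodType).

HB.instance Definition _ := GRing.Zmodule.copy (grpring R G) {ffun G -> R}.

Definition gelt (g : G) : grpring R G := [ffun h => (h == g)%:R].

Definition grpring_mul (u v : grpring R G) : grpring R G :=
  [ffun g => \sum_(h : G) u h * v (g - h)].

Fact grpring_mulC : commutative grpring_mul.
Proof.
move=> u v; apply/ffunP => g; rewrite !ffunE.
rewrite (reindex_inj (can_inj (subKr g))) /=.
by apply: eq_bigr => h _; rewrite subKr mulrC.
Qed.

Fact grpring_mulA : associative grpring_mul.
Proof.
move=> u v w; apply/ffunP => g; rewrite !ffunE.
under eq_bigr do rewrite ffunE mulr_sumr.
under [RHS]eq_bigr do rewrite ffunE mulr_suml.
rewrite [RHS]exchange_big /=; apply: eq_bigr => k _.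
rewrite [RHS](reindex_inj (addrI k)) /=; apply: eq_bigr => h _.
by rewrite mulrA [k + h]addrC addrK opprD addrA addrAC.
Qed.

Fact grpring_mul1 : left_id (gelt 0) grpring_mul.
Proof.
move=> u; apply/ffunP => g; rewrite !ffunE (bigD1 0) //= big1 ?addr0.
  by rewrite ffunE eqxx mul1r subr0.
by move=> h /negbTE h0; rewrite ffunE h0 mul0r.
Qed.

Fact grpring_mulDl : left_distributive grpring_mul +%R.
Proof.
move=> u v w; apply/ffunP => g; rewrite !ffunE -big_split /=.
by apply: eq_bigr => h _; rewrite ffunE mulrDl.
Qed.

Fact grpring_1neq0 : gelt 0 != 0.
Proof.
by apply/eqP => /ffunP/(_ 0); rewrite !ffunE eqxx => /eqP; rewrite oner_eq0.
Qed.

HB.instance Definition _ := GRing.Zmodule_isComNzRing.Build (grpring R G)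
  grpring_mulA grpring_mulC grpring_mul1 grpring_mulDl grpring_1neq0.

End GroupRing.

Section GroupRingMap.
Variables (R R' : comNzRingType) (G G' : finZmodType).
Variables (phi : {rmorphism R -> R'}) (psi : {additive G -> G'}).

(* [sum_g c_g g] is sent to [sum_g (phi c_g) (psi g)]. *)
Definition grpring_map (u : grpring R G) : grpring R' G' :=
  [ffun g' => \sum_(g | psi g == g') phi (u g)].

Fact grpring_map_zmod_morphism : zmod_morphism grpring_map.
Proof.
move=> u v; apply/ffunP => g'; rewrite !ffunE -sumrB.
by apply: eq_bigr => g _; rewrite !ffunE rmorphB.
Qed.

Fact grpring_map_gelt g : grpring_map (gelt R g) = gelt R' (psi g).
Proof.
apply/ffunP => g'; rewrite !ffunE eq_sym.
case: eqP => [<-|ne].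
  rewrite (bigD1 g) //= big1 ?addr0; first by rewrite ffunE eqxx rmorph1.
  by move=> h /andP[_ /negbTE hg]; rewrite ffunE hg rmorph0.
apply: big1 => h /eqP hg'; rewrite ffunE.
by case: eqP => [E|_]; rewrite ?rmorph0 //; case: ne; rewrite -E.
Qed.

Fact grpring_map_monoid_morphism : monoid_morphism grpring_map.
Proof.
split=> [|u v]; first by rewrite grpring_map_gelt raddf0.
apply/ffunP => g'; rewrite !ffunE.
under eq_bigr do rewrite ffunE rmorph_sum.
rewrite exchange_big /= (partition_big psi predT) //=.
apply: eq_bigr => h' _; rewrite !ffunE mulr_suml.
apply: eq_bigr => h /eqP psih; rewrite mulr_sumr.
rewrite (reindex_inj (addIr h)) /=; apply: eq_big => [k|k _].
  by rewrite raddfD /= psih eq_sym -subr_eq eq_sym.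
by rewrite addrK rmorphM.
Qed.

HB.instance Definition _ := GRing.isZmodMorphism.Build
  (grpring R G) (grpring R' G') grpring_map grpring_map_zmod_morphism.
HB.instance Definition _ := GRing.isMonoidMorphism.Build
  (grpring R G) (grpring R' G') grpring_map grpring_map_monoid_morphism.

End GroupRingMap.

Definition ZhatZhat_system := InvSystem (0, 0)
  (fun (p q : nat * nat)
       (h : (p.1.+2 %| q.1.+2)%N /\ (p.2.+2 %| q.2.+2)%N) =>
   grpring_map (Zred (proj1 h)) (Zred (proj2 h)) :
     {rmorphism grpring 'Z_q.1.+2 'Z_q.2.+2 -> grpring 'Z_p.1.+2 'Z_p.2.+2}).

Definition ZhatZhat := invlim ZhatZhat_system.
HB.instance Definition _ := GRing.ComUnitRing.on ZhatZhat.

Section GroupElement.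
Variable nu : Zhat.

Definition tpow_comp (p : nat * nat) : grpring 'Z_p.1.+2 'Z_p.2.+2 :=
  gelt 'Z_p.1.+2 (proj (S := Zhat_system) p.2 nu).

Fact tpow_subproof (p q : idx ZhatZhat_system) (h : ord p q) :
  tr h (tpow_comp q) = tpow_comp p.
Proof.
rewrite [LHS]grpring_map_gelt; congr gelt.
exact: (proj_tr (S := Zhat_system) (proj2 h) nu).
Qed.

(* The group element [t ^ nu]. *)
Definition tpow : ZhatZhat := exist _ tpow_comp tpow_subproof.

End GroupElement.

(* [{malg int[int]}] is the free abelian group on Z: [f@_k] is the coefficient
   of [t ^ k], [<< a *g k >>] is the monomial [a t ^ k] and [msupp f] is the
   finite set of the exponents that occur in [f]. *)
Definition laurent := {malg int[int]}.

Definition laurent_monic (f : laurent) : Prop :=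
  exists d : int, f@_d = 1 /\ forall k, d < k -> f@_k = 0.

(* The sum is [t ^ N f(t ^ -1)]. *)
Definition laurent_reciprocal (f : laurent) : Prop :=
  exists N : int, f = \sum_(k <- msupp f) << f@_k *g N - k >>.

Definition laurent_root (F : fieldType) (f : laurent) (x : F) : Prop :=
  x != 0 /\ \sum_(k <- msupp f) (f@_k)%:~R * x ^ k = 0.

(* [f(t ^ mu)], the sum of the [a_k t ^ (k mu)]; [f(t)] is the case [mu = 1]. *)
Definition laurent_at (f : laurent) (mu : Zhat) : ZhatZhat :=
  \sum_(k <- msupp f) tpow (mu *~ k) *~ f@_k.

Definition principal_ideal (A : comPzRingType) (x : A) : set A :=
  range (fun y : A => y * x).

(* Main.v *)
From HB Require Import structures.
Require Import Defs.
From mathcomp Require Import all_boot all_order all_algebra all_field.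
From mathcomp Require Import boolp finmap monalg.
From mathcomp Require Import zify ring.

(** Write [f = t^e g] with [g] monic, palindromic and [g(0) = 1], and let [r] be
the degree of [g]. If [b = a mu] modulo [n], the equality of ideals shows that
[g(t^a)] and [g(t^b)] divide each other in [(Z/q)[t]/(t^n - 1)] for all [q].
Let [alpha] be a root of [g] of maximal modulus. If [|alpha| <= 1], then all
roots lie on the unit circle, since [g] is palindromic, and they are roots of
unity (Kronecker). Otherwise let [x] run over the numbers such that [x^a] is a
conjugate of [alpha]. The integer [prod_x (x^n - 1)] divides [prod_x g(x^b)];
for [a] bounded, [b <= n/(2r)] and suitable [n], the former has modulus about
[M^n] and the latter at most about [M^(n/2)], where [M > 1] is the product of
the [max(1, |x|)]. So [g(x^b) = 0] for some [x], whence [alpha^b = z^a] for some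
root [z] of [g], and [b <= a] by maximality of [|alpha|]. By the pigeonhole
principle there are [0 < a <= 2r] and [0 <= b <= n/(2r)] with [a mu = b] or
[a mu = - b] modulo [n]; exchanging [a] and [b] gives [a = b], so that [(2r)!]
kills [mu - 1] or [mu + 1] modulo [n]. This holds for [n] in a cofinal set, and
[Zhat] is torsion-free. *)

Set Implicit Arguments.
Unset Strict Implicit.
Unset Printing Implicit Defensive.

Import Order.TTheory GRing.Theory Num.Theory.
Local Open Scope ring_scope.

Local Notation intpC := (map_poly (intr : int -> algC)).
Local Notation intpQ := (map_poly (intr : int -> rat)).

(** * Lower bounds for [x^n - 1] *)

(** Simultaneous Dirichlet approximation: by pigeonhole, two exponents [k1 < k2] put [y ^+ k1] and
    [y ^+ k2] in a common square cell of side [1 / M] for every [y]. Dividing by [y ^+ k1], of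
    modulus 1, gives [K = k2 - k1]. *)
Lemma circle_recurrence (s : seq algC) (M : nat) :
  (0 < M)%N -> {in s, forall y, `|y| = 1} ->
  exists2 K, (0 < K)%N & {in s, forall y, `|y ^+ K - 1| * M%:R <= 2}.
Proof.
move=> M0 s1.
pose T := {ffun 'I_(size s) -> 'I_M.*2.+1 * 'I_M.*2.+1}.
(* For real [u] between -1 and 1 the shifted floor lies between 0 and [2 * M], so [inord] loses
   nothing. *)
pose cell (u : algC) : 'I_M.*2.+1 := inord `|Num.floor (u * M%:R) + M%:Z|.
pose F (k : 'I_#|T|.+1) : T :=
  [ffun i : 'I_(size s) =>
     (cell ('Re (s`_i ^+ k)), cell ('Im (s`_i ^+ k)))].
have /injectivePn[k1 [k2 k12 Fk]] : ~~ injectiveb F.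
  by apply/negP => /injectiveP/leq_card; rewrite card_ord ltnn.
have M0' : (0 : algC) < M%:R by rewrite ltr0n.
have cellP (u v : algC) : u \is Num.real -> v \is Num.real -> `|u| <= 1 -> `|v| <= 1 ->
    cell u = cell v -> `|u - v| * M%:R <= 1.
  have bnd (w : algC) : w \is Num.real -> `|w| <= 1 ->
      - M%:Z <= Num.floor (w * M%:R) <= M%:Z.
    move=> wr; rewrite real_ler_norml // => /andP[w1 w2].
    have wMr : w * M%:R \is Num.real by rewrite rpredM ?realn.
    rewrite real_floor_ge_int // -ltzD1 real_floor_lt_int //.
    rewrite intrN -[X in X <= _]mulN1r ler_pM2r // w1 intrD /=.
    by apply: (@le_lt_trans _ _ M%:R); rewrite ?ler_piMl ?ltrDl // ltW.
  move=> ur vr u1 v1 /(congr1 val).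
  have /andP[a1 a2] := bnd u ur u1; have /andP[b1 b2] := bnd v vr v1.
  rewrite /= !inordK; try lia.
  move=> E; have {}E : Num.floor (u * M%:R) = Num.floor (v * M%:R) by lia.
  have uMr : u * M%:R \is Num.real by rewrite rpredM ?realn.
  have vMr : v * M%:R \is Num.real by rewrite rpredM ?realn.
  have:= real_floor_le uMr; have := real_floor_le vMr.
  have := real_floorD1_gt uMr; have := real_floorD1_gt vMr.
  rewrite -E !intrD => v3 u3 v4 u4.
  rewrite -[M%:R]gtr0_norm // -normrM mulrBl.
  rewrite real_ler_norml ?rpredB // lerBrDr lerBlDr.
  apply/andP; split.
    rewrite addrC -lerBrDr opprK; apply: le_trans (ltW v3) _.
    by rewrite lerD2r.
  by apply: le_trans (ltW u3) _; rewrite addrC lerD2l.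
have close y : y \in s -> `|y ^+ k1 - y ^+ k2| * M%:R <= 2.
  move=> ys; have ilt : (index y s < size s)%N by rewrite index_mem.
  have /ffunP/(_ (Ordinal ilt)) := Fk; rewrite !ffunE /= nth_index // => -[E1 E2].
  have yk k : `|y ^+ k| = 1 by rewrite normrX s1 // expr1n.
  have Re1 (u : algC) : `|u| = 1 -> `|'Re u| <= 1.
    by move=> <-; rewrite leif_normC_Re_Creal.
  have Im1 (u : algC) : `|u| = 1 -> `|'Im u| <= 1.
    by move=> u1; rewrite -normrN -ReMil Re1 // normrM normCi mul1r.
  rewrite [X in `|X|]Crect. 
  have := ler_normD ('Re (y ^+ k1 - y ^+ k2)) ('i * 'Im (y ^+ k1 - y ^+ k2)).
  rewrite normrM normCi mul1r !raddfB /=.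
  move=> /(ler_wpM2r (ltW M0')) /le_trans; apply.
  rewrite mulrDl -[2]/(1 + 1) lerD //; apply: cellP;
    by rewrite ?Creal_Re ?Creal_Im ?Re1 ?Im1.
wlog k12' : k1 k2 k12 close {Fk} / (k1 < k2)%N.
  move=> H; case: (ltngtP k1 k2) => [|lt|/val_inj/eqP]; first exact: H.
    by apply: (H k2 k1); rewrite // 1?eq_sym // => y ys; rewrite distrC close.
  by rewrite (negPf k12).
exists (k2 - k1)%N; first by rewrite subn_gt0.
move=> y ys; have := close y ys; rewrite distrC -{1}(subnKC (ltnW k12')) exprD.
by rewrite -[X in _ - X]mulr1 -mulrBr normrM normrX s1 // expr1n mul1r.
Qed.

(** The product of [max1] over the roots of a monic polynomial is its Mahler measure. *)
Definition max1 (x : algC) : algC := if `|x| <= 1 then 1 else `|x|.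

Lemma max1_ge1 x : 1 <= max1 x.
Proof.
rewrite /max1; case: ifP => // /negbT; rewrite -real_ltNge ?normr_real //.
exact: ltW.
Qed.

Lemma max1_gt0 x : 0 < max1 x.
Proof. exact: lt_le_trans ltr01 (max1_ge1 x). Qed.

Lemma ler_max1 x : `|x| <= max1 x.
Proof. by rewrite /max1; case: ifP => // _; exact: lexx. Qed.

Lemma max1X x n : max1 (x ^+ n) = max1 x ^+ n.
Proof.
case: n => [|n]; first by rewrite !expr0 /max1 normr1 lexx.
rewrite /max1 normrX expr_le1 //.
by case: ifP => _; rewrite ?expr1n.
Qed.

Lemma seq_lower_bound (s : seq algC) (F : algC -> algC) :
  {in s, forall y, 0 < F y} -> exists2 c, 0 < c & {in s, forall y, c <= F y}.
Proof.
elim: s => [|y s IH] Fpos; first by exists 1.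
have [z zs|c c0 cs] := IH; first by apply: Fpos; rewrite inE zs orbT.
have y0 : 0 < F y by apply: Fpos; rewrite mem_head.
have [le|le] := real_leP (gtr0_real c0) (gtr0_real y0).
  by exists c => // z; rewrite inE => /predU1P[->|/cs].
exists (F y) => // z; rewrite inE => /predU1P[->//|/cs].
exact/le_trans/ltW.
Qed.

(* For conjugates on the unit circle no effective lower bound for a given [n] is
   needed: [y ^+ n] returns close to [y ^+ n0] for infinitely many [n], and [c]
   does not depend on [n]. *)
Lemma powers_away_from_one (s : seq algC) (n0 : nat) :
  (0 < n0)%N -> {in s, forall y k, (0 < k)%N -> y ^+ k != 1} ->
  exists2 c, 0 < c & forall B, exists n,
    [/\ (B < n)%N, (n0 %| n)%N
      & {in s, forall y, c * max1 y ^+ n <= `|y ^+ n - 1|}].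
Proof.
move=> n00 sN1.
(* Off the circle, [F y] bounds [|y ^+ n - 1| / max1 y ^+ n] from below for all [n > 0]. On it,
   halving the distance from [y ^+ n0] to 1 leaves room for an error of size [c]. *)
pose F (y : algC) := if `|y| == 1 then `|y ^+ n0 - 1| / 2
  else if `|y| <= 1 then 1 - `|y| else 1 - `|y|^-1.
have [y ys|c c0 cs] := @seq_lower_bound s F.
  rewrite /F; case: eqVneq => [y1|yn1].
    by rewrite divr_gt0 ?ltr0n // normr_gt0 subr_eq0 sN1.
  case: ifPn => [y1|]; first by rewrite subr_gt0 lt_neqAle yn1.
  rewrite -real_ltNge ?normr_real // => y1.
  by rewrite subr_gt0 invf_lt1 // (lt_trans ltr01).
exists c => // B.
pose M := (Num.bound (2 / c)).
have Mc : 2 <= c * M%:R.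
  rewrite mulrC -ler_pdivrMr //; have := archi_boundP (divr_ge0 (ler0n _ 2) (ltW c0)).
  exact: ltW.
have M0 : (0 < M)%N.
  by rewrite lt0n; apply: contraTneq Mc => ->; rewrite mulr0 -real_ltNge ?realn ?ltr0n.
(* Recurrence is applied to the [y ^+ N]: then [n0 + N * K] is a multiple of [n0] above [B], and
   [y ^+ (N * K)] is within [2 / M <= c] of 1. *)
pose N := (n0 * B.+1)%N.
have [_ /mapP[y + ->]|K K0 HK] :=
    @circle_recurrence [seq y ^+ N | y <- s & `|y| == 1] M M0.
  by rewrite mem_filter => /andP[/eqP y1 _]; rewrite normrX y1 expr1n.
exists (n0 + N * K)%N; split.
- by rewrite /N; nia.
- by rewrite dvdn_addr // /N -mulnA dvdn_mulr.
move=> y ys; have := cs y ys; rewrite /F.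
have n'0 : (0 < n0 + N * K)%N by lia.
case: eqVneq => [y1|yn1] Fy.
  rewrite /max1 y1 lexx expr1n mulr1.
  have /HK : y ^+ N \in [seq y ^+ N | y <- s & `|y| == 1].
    by apply: map_f; rewrite mem_filter y1 eqxx.
  move=> /le_trans/(_ Mc); rewrite ler_pM2r ?ltr0n // -exprM => small.
  have -> : y ^+ (n0 + N * K) - 1 = (y ^+ n0 - 1) + y ^+ n0 * (y ^+ (N * K) - 1).
    by rewrite exprD; ring.
  apply: le_trans (lerB_normD _ _); rewrite normrM normrX y1 expr1n mul1r.
  rewrite lerBrDr (le_trans (lerD (lexx c) small)) //.
  by move: Fy; rewrite ler_pdivlMr ?ltr0n // mulrDr mulr1.
move: Fy; rewrite /max1; case: ifPn => [y1|y1] Fy.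
  rewrite expr1n mulr1 (le_trans Fy) // distrC.
  apply: le_trans (lerB_dist _ _); rewrite normr1 lerB // normrX.
  by rewrite -[leRHS]expr1 ler_wiXn2l.
move: y1; rewrite -real_ltNge ?normr_real // => y1.
have y0 := lt_trans ltr01 y1.
apply: le_trans (lerB_dist _ _); rewrite normr1 normrX.
apply: le_trans (ler_wpM2r _ Fy) _; first by rewrite exprn_ge0.
rewrite mulrBl mul1r lerB // -(prednK n'0) exprS mulKf ?gt_eqF //.
by rewrite exprn_ege1 // ltW.
Qed.

(** As [y ^+ n = (x ^+ n) ^+ a], the difference [y ^+ n - 1] is [x ^+ n - 1] times a geometric sum
    of modulus at most [a * max1 x ^+ (n * a.-1)]. *)
Lemma root_power_away (x y c : algC) (a n : nat) :
  (0 < a)%N -> x ^+ a = y -> c * max1 y ^+ n <= `|y ^+ n - 1| ->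
  c / a%:R * max1 x ^+ n <= `|x ^+ n - 1|.
Proof.
move=> a0 <-; have m0 k : 0 < max1 x ^+ k by rewrite exprn_gt0 ?max1_gt0.
have sum_le : `|\sum_(i < a) (x ^+ n) ^+ i| <= a%:R * max1 x ^+ (n * a.-1).
  apply: le_trans (ler_norm_sum _ _ _) _.
  rewrite -[X in X%:R]card_ord -sum1_card natr_sum mulr_suml ler_sum // => i _.
  rewrite mul1r -exprM normrX (le_trans (lerXn2r _ _ _ (ler_max1 x))) ?nnegrE //.
    exact: ltW (max1_gt0 x).
  by rewrite ler_weXn2l ?max1_ge1 // leq_mul2l -ltnS prednK // ltn_ord orbT.
rewrite max1X -!exprM mulnC (exprM x) subrX1 normrM => H.
have := le_trans H (ler_wpM2l (normr_ge0 _) sum_le).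
rewrite -[in X in max1 x ^+ X](prednK a0) mulnS exprD !mulrA.
by rewrite ler_pM2r // mulrAC ler_pdivrMr ?ltr0n.
Qed.

Lemma prodr_const_seq (R : pzSemiRingType) (I : Type) (r : seq I) (c : R) :
  \prod_(i <- r) c = c ^+ size r.
Proof. by rewrite big_const_seq count_predT iter_mulr_1. Qed.

Lemma prod_max1_ge1 (X : seq algC) : 1 <= \prod_(x <- X) max1 x.
Proof. by elim/big_rec: _ => // x y _; apply/mulr_ege1/max1_ge1. Qed.

(** Let [M] be the product of the [max1 x]. Up to constants, the first product is at least [M ^+ n]
    and the second at most [M ^+ (b * size G)], where the exponent is at most [n / 2]. This bounds
    [M ^+ n], and [rho <= M ^+ a]. *)
Lemma norm_size_bound (X G : seq algC) (rho c x0 : algC) (a A b n : nat) :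
  1 <= rho -> 0 < c -> (0 < a <= A)%N -> (2 * (b * size G) <= n)%N ->
  {in G, forall z, `|z| <= rho} -> x0 \in X -> `|x0| ^+ a = rho ->
  {in X, forall x, c / a%:R * max1 x ^+ n <= `|x ^+ n - 1|} ->
  \prod_(x <- X) `|x ^+ n - 1| <= \prod_(x <- X) \prod_(z <- G) `|x ^+ b - z| ->
  rho ^+ n <= (1 + A%:R / c * (2 * rho) ^+ size G) ^+ (2 * a * size X).
Proof.
move=> rho1 c0 /andP[a0 aA] bn Grho x0X x0rho Xlow Hle.
have rho0 : 0 < rho := lt_le_trans ltr01 rho1.
have a0' : (0 : algC) < a%:R by rewrite ltr0n.
have ca0 : 0 < c / a%:R by rewrite divr_gt0.
pose M := \prod_(x <- X) max1 x.
have M1 : 1 <= M := prod_max1_ge1 X.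
have M0 : 0 < M := lt_le_trans ltr01 M1.
pose Q := a%:R / c * (2 * rho) ^+ size G.
have Q0 : 0 <= Q.
  by rewrite mulr_ge0 ?exprn_ge0 ?divr_ge0 ?mulr_ge0 ?ler0n // ltW.
have MQ : M ^+ n <= Q ^+ size X * M ^+ (b * size G).
  have low : (c / a%:R) ^+ size X * M ^+ n <= \prod_(x <- X) `|x ^+ n - 1|.
    rewrite -prodrXl -(prodr_const_seq X) -big_split /=.
    rewrite big_seq [leRHS]big_seq; apply: ler_prod => x xX.
    by rewrite Xlow // andbT mulr_ge0 ?exprn_ge0 // ?ltW ?max1_gt0.
  have up : \prod_(x <- X) \prod_(z <- G) `|x ^+ b - z| <=
      ((2 * rho) ^+ size G) ^+ size X * M ^+ (b * size G).
    rewrite -prodrXl -(prodr_const_seq X) -big_split /=.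
    apply: ler_prod => x _; rewrite prodr_ge0 //= exprM -exprMn.
    rewrite -(prodr_const_seq G).
    rewrite big_seq [leRHS]big_seq; apply: ler_prod => z zG.
    rewrite normr_ge0 (le_trans (ler_normB _ _)) // mulrDl mul1r mulrDl.
    have m1 : 1 <= max1 x ^+ b by rewrite exprn_ege1 ?max1_ge1.
    rewrite lerD //.
      rewrite normrX (le_trans (lerXn2r _ _ _ (ler_max1 x))) ?nnegrE //.
        exact: ltW (max1_gt0 x).
      by rewrite ler_peMl // (le_trans ler01).
    by rewrite (le_trans (Grho z zG)) // ler_peMr // ltW.
  have := le_trans low (le_trans Hle up).
  rewrite mulrC -ler_pdivlMr ?exprn_gt0 // => /le_trans; apply.
  by rewrite mulrAC -expr_div_n /Q invf_div [_ / _ * _]mulrC.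
(* After squaring, the power of [M] on the right is at most [M ^+ n], which cancels. *)
have MQ2 : M ^+ n <= Q ^+ (2 * size X).
  rewrite -(ler_pM2r (exprn_gt0 n M0)).
  have MQ' : (M ^+ n) ^+ 2 <= (Q ^+ size X * M ^+ (b * size G)) ^+ 2.
    by rewrite lerXn2r ?nnegrE ?mulr_ge0 ?exprn_ge0 ?(ltW M0).
  rewrite -expr2 (le_trans MQ') // exprMn -!exprM [(size X * 2)%N]mulnC.
  by rewrite ler_wpM2l ?exprn_ge0 // ler_weXn2l // mulnC.
rewrite -{1}x0rho -exprM.
apply: (@le_trans _ _ (M ^+ (a * n))).
  rewrite lerXn2r ?nnegrE ?normr_ge0 ?(ltW M0) //.
  rewrite /M (big_rem _ x0X) /= (le_trans (ler_max1 _)) //.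
  rewrite ler_peMr ?(ltW (max1_gt0 _)) //.
  exact: prod_max1_ge1.
rewrite mulnC exprM -mulnA [(a * _)%N]mulnC mulnA exprM.
(* [Q] is replaced by a bound in [A] instead of [a]; the summand 1 makes it at least 1, so that its
   exponent can later be enlarged. *)
have E0 : 0 <= A%:R / c * (2 * rho) ^+ size G.
  by rewrite mulr_ge0 ?exprn_ge0 ?divr_ge0 ?mulr_ge0 ?ler0n // ltW.
have E1 : 0 <= 1 + A%:R / c * (2 * rho) ^+ size G by rewrite addr_ge0.
rewrite lerXn2r ?nnegrE ?exprn_ge0 ?(ltW M0) //. rewrite (le_trans MQ2) //.
rewrite lerXn2r ?nnegrE // (@le_trans _ _ (A%:R / c * (2 * rho) ^+ size G)) ?lerDr //.
rewrite ler_wpM2r ?exprn_ge0 ?mulr_ge0 ?(ltW rho0) //.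
by rewrite ler_wpM2r ?invr_ge0 ?(ltW c0) // ler_nat.
Qed.

(** * Norms and conjugates *)

Lemma horner_char_poly (R : comNzRingType) (n : nat) (A : 'M[R]_n) (z : R) :
  (char_poly A).[z] = \det (z%:M - A).
Proof.
rewrite -[LHS]/(horner_eval z _) -det_map_mx; congr (\det _).
apply/matrixP => i j; rewrite /char_poly_mx !mxE /= /horner_eval.
by rewrite hornerD hornerN hornerMn hornerX hornerC.
Qed.

(** Both sides are multiplicative in [P], so linear factors suffice. For ['X - z%:P] this is the
    characteristic polynomial at [z], with one sign for each of the [n.+1] roots. *)
Lemma det_horner_mx_roots (F : closedFieldType) (n : nat) (A : 'M[F]_n.+1)
    (s : seq F) (P : {poly F}) :
  char_poly A = \prod_(r <- s) ('X - r%:P) ->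
  \det (horner_mx A P) = \prod_(r <- s) P.[r].
Proof.
move=> chA.
have szs : size s = n.+1.
  by apply: succn_inj; rewrite -(size_char_poly A) chA size_prod_XsubC.
have detXsub z : \det (horner_mx A ('X - z%:P)) = \prod_(r <- s) (r - z).
  have chz : \det (z%:M - A) = \prod_(r <- s) (z - r).
    rewrite -horner_char_poly chA horner_prod.
    by apply: eq_bigr => r _; rewrite hornerXsubC.
  rewrite rmorphB /= horner_mx_X horner_mx_C -opprB -scaleN1r detZ chz -szs.
  rewrite -prodr_const_seq -big_split; apply: eq_bigr => r _ /=.
  by rewrite mulN1r opprB.
have [t ->] := closed_field_poly_normal P.
rewrite -mul_polyC rmorphM /= horner_mx_C -mulmxE detM det_scalar.
under [RHS]eq_bigr do rewrite hornerM hornerC horner_prod.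
rewrite big_split prodr_const_seq szs; congr (_ * _).
rewrite exchange_big rmorph_prod /=.
elim: t => [|z t IH]; first by rewrite !big_nil det1.
rewrite !big_cons -mulmxE detM IH detXsub; congr (_ * _).
by apply: eq_bigr => r _; rewrite hornerXsubC.
Qed.

(** This is how products over all conjugates are recognized as integers. *)
Lemma int_det_horner_mx_roots (n : nat) (A : 'M[int]_n.+1) (s : seq algC)
    (P : {poly int}) :
  intpC (char_poly A) = \prod_(r <- s) ('X - r%:P) ->
  (\det (horner_mx A P))%:~R = \prod_(r <- s) (intpC P).[r].
Proof.
move=> chA; rewrite -det_map_mx map_horner_mx; apply: det_horner_mx_roots.
by rewrite -map_char_poly.
Qed.

Lemma companion_ex (p : {poly int}) : p \is monic -> (1 < size p)%N ->
  exists n, exists C : 'M[int]_n.+1, char_poly C = p.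
Proof.
move=> pm p1; have := companionmxK pm; move: (companionmx p).
by case: (size p) p1 => [|[|n]] // _ C chC; exists n, C.
Qed.

Lemma Zp_int_eq0 (k : nat) (x : int) :
  (x%:~R == 0 :> 'Z_k.+2) = (k.+2 %| `|x|)%N.
Proof.
have natr0 m : (m%:R == 0 :> 'Z_k.+2) = (k.+2 %| m)%N.
  by rewrite -val_eqE /= val_Zp_nat.
by case: (intP x) => [|m|m]; rewrite ?intrN ?oppr_eq0 ?abszN -natr0.
Qed.

(* Both products are determinants of polynomials in the companion matrix [C] of
   [p], which annihilates [F]; reducing modulo twice the determinant of [H(C)]
   shows that it divides that of [G(C)]. *)
Lemma norm_prod_le (p F G H : {poly int}) (s : seq algC) :
  p \is monic -> (1 < size p)%N -> intpC p = \prod_(r <- s) ('X - r%:P) ->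
  (exists W, F = W * p) ->
  (forall k, exists Y Z : {poly 'Z_k.+2},
     map_poly intr G = Y * map_poly intr F + Z * map_poly intr H) ->
  \prod_(r <- s) (intpC H).[r] != 0 -> \prod_(r <- s) (intpC G).[r] != 0 ->
  \prod_(r <- s) `|(intpC H).[r]| <= \prod_(r <- s) `|(intpC G).[r]|.
Proof.
move=> pm p1 ps [W FW] modG H0 G0; have [n [C chC]] := companion_ex pm p1.
rewrite -chC in ps; move: H0 G0.
rewrite -!normr_prod -!(int_det_horner_mx_roots _ ps) !intr_eq0 -!intr_norm.
set DH := \det _; set DG := \det _ => H0 G0.
rewrite ler_int -!abszE lez_nat dvdn_leq ?absz_gt0 //.
(* The factor 2 keeps the modulus at least 2 even when [|DH|] is 1. *)
have [k kE] : exists k, k.+2 = (2 * `|DH|)%N.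
  by exists (2 * `|DH|).-2; have : (0 < `|DH|)%N; [rewrite absz_gt0|lia].
have [Y [Z YZ]] := modG k.
pose C' := map_mx (intr : int -> 'Z_k.+2) C.
have red P : (\det (horner_mx C P))%:~R = \det (horner_mx C' (map_poly intr P)).
  by rewrite -map_horner_mx det_map_mx.
have pC0 : horner_mx C' (map_poly intr p) = 0.
  by rewrite -map_horner_mx -chC Cayley_Hamilton raddf0.
have := red G; rewrite YZ FW (rmorphM (map_poly intr)) rmorphD !rmorphM /=.
(* The cofactor of [DH] is lifted to a natural number [z], so that the congruence can be read in the
   integers. *)
rewrite pC0 !mulr0 add0r -mulmxE detM -red -/DH -/DG -[\det _]natr_Zp.
move: (nat_of_ord _) => z /eqP.
rewrite -subr_eq0 pmulrn -intrM -intrB Zp_int_eq0 kE => dv.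
have {dv} : (DH %| DG - z%:Z * DH)%Z.
  by rewrite dvdzE (dvdn_trans _ dv) // dvdn_mull.
by move/rpredD/(_ (dvdz_mull z (dvdzz DH))); rewrite subrK dvdzE.
Qed.

Lemma intpQC (p : {poly int}) : map_poly ratr (intpQ p) = intpC p.
Proof. by rewrite -map_poly_comp; apply: eq_map_poly => x /=; rewrite ratr_int. Qed.

(** The minimal polynomial [q'] of [y] divides that of [x], say [q = u * q']. Since [u] has smaller
    degree than [q], it does not vanish at [x]; so [q'] does, and [q] and [q'] divide each other. *)
Lemma root_minCpoly_conj (x y : algC) (p : {poly int}) :
  root (minCpoly x) y -> root (intpC p) x = root (intpC p) y.
Proof.
have [q [qE qm] qP] := minCpolyP x; rewrite qE => qy.
have [q' [q'E q'm] q'P] := minCpolyP y.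
suffices qq' : q %| q'.
  have /eqp_dvdl dvE : q %= q' by rewrite /eqp qq' -q'P.
  by rewrite -!intpQC qP q'P dvE.
have := qy; rewrite q'P => /dvdpP[u qu].
have u0 : u != 0.
  by apply: contraTneq qm => u0; rewrite qu u0 mul0r monicE lead_coef0 eq_sym oner_eq0.
have : root (map_poly ratr q) x by rewrite qP.
rewrite qu rmorphM rootM !qP -qu => /orP[/dvdp_leq|//].
rewrite u0 qu size_mul ?(monic_neq0 q'm) // => /(_ isT).
have := size_minCpoly y; rewrite q'E size_map_poly.
by move: (size q') (size u) => [|[|m]] //= k _; rewrite addnS /= addnS ltnNge leq_addr.
Qed.

(** An algebraic integer has an integral minimal polynomial [p]. Division by the monic [p] stays in
    the integers, and the remainder vanishes at [x] in too small a degree to be nonzero. *)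
Lemma int_minCpoly (g : {poly int}) (x : algC) : g \is monic ->
  root (intpC g) x ->
  exists p W : {poly int}, [/\ p \is monic, intpC p = minCpoly x & g = W * p].
Proof.
move=> gm gx.
have xA : x \in Aint.
  apply: root_monic_Aint gx _ _; first by rewrite monic_map.
  by apply/polyOverP => i; rewrite coef_map rpred_int.
have [p pE] := floorpP xA.
have pm : p \is monic.
  rewrite monicE -(inj_eq (@intr_inj algC)) -lead_coef_map_inj //; last exact: intr_inj.
  by rewrite -pE (monicP (minCpoly_monic x)).
exists p, (Pdiv.Ring.rdivp g p); split=> //.
rewrite [LHS](Pdiv.RingMonic.rdivp_eq pm) -[RHS]addr0; congr (_ + _).
set r := Pdiv.Ring.rmodp g p.
have : root (intpC r) x.
  move: gx; rewrite [g in X in X -> _](Pdiv.RingMonic.rdivp_eq pm).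
  rewrite rmorphD rmorphM /= -pE !rootE hornerD hornerM.
  by rewrite (eqP (root_minCpoly x)) mulr0 add0r.
have [q [qE qm] qP] := minCpolyP x.
rewrite -intpQC qP => /dvdp_leq le.
apply/eqP; apply: contraTT isT => r0; move: le.
rewrite -(size_map_poly (ratr : {rmorphism rat -> algC}) q) -qE pE.
rewrite !size_map_inj_poly ?rmorph0 //; try exact: intr_inj.
rewrite map_poly_eq0_id0; last by rewrite intr_eq0 lead_coef_eq0.
move=> /(_ r0); rewrite leqNgt Pdiv.Ring.ltn_rmodp.
by rewrite monic_neq0.
Qed.

(* The polynomial [prod_z (X^b - z^a)] is rational, so its set of roots is
   stable under conjugation. *)
Lemma conjugate_power_relation (g : {poly int}) (G : seq algC) (a b : nat)
    (x y z : algC) :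
  g \is monic -> intpC g = \prod_(r <- G) ('X - r%:P) -> root (minCpoly x) y ->
  z \in G -> y ^+ b = z ^+ a -> exists2 z', z' \in G & x ^+ b = z' ^+ a.
Proof.
move=> gm gG xy zG yz.
have g1 : (1 < size g)%N.
  rewrite -(size_map_inj_poly (@intr_inj algC)) // gG size_prod_XsubC.
  by case: (G) zG.
have [n [C chC]] := companion_ex gm g1; rewrite -chC in gG.
(* [C ^+ a] has the eigenvalues [r ^+ a], so the value of [W] at [u] is the product of the
   [u ^+ b - r ^+ a]. *)
pose W := char_poly (C ^+ a) \Po 'X^b.
have mapX k : map_mx intr (C ^+ k) = map_mx intr C ^+ k :> 'M[algC]_n.+1.
  by elim: k => [|k IH]; rewrite ?expr0 ?map_mx1 // !exprS -!mulmxE map_mxM IH.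
have rootW u : root (intpC W) u = (\prod_(r <- G) (u ^+ b - r ^+ a) == 0).
  rewrite rootE map_comp_poly map_polyXn horner_comp hornerXn map_char_poly.
  rewrite horner_char_poly mapX.
  have -> : (u ^+ b)%:M - map_mx intr C ^+ a =
      horner_mx (map_mx intr C) ((u ^+ b)%:P - 'X^a) :> 'M[algC]_n.+1.
    by rewrite rmorphB /= horner_mx_C (rmorphXn (horner_mx _)) /= horner_mx_X.
  rewrite (@det_horner_mx_roots _ _ _ G) -?map_char_poly //.
  by under eq_bigr do rewrite hornerD hornerN hornerC hornerXn.
have : root (intpC W) x.
  rewrite (root_minCpoly_conj W xy) rootW prodf_seq_eq0.
  by apply/hasP; exists z; rewrite // yz subrr eqxx.
rewrite rootW prodf_seq_eq0 => /hasP[z' z'G]; rewrite subr_eq0 => /eqP E.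
by exists z'.
Qed.

(** Recurrence with [M = 3] gives [|y ^+ K - 1| <= 2 / 3] for all conjugates [y] of [x]. The product
    of the [y ^+ K - 1] is an integer of modulus less than 1, hence 0, and one vanishing factor
    makes [x ^+ K = 1]. *)
Lemma kronecker_unity_root (g : {poly int}) (x : algC) : g \is monic ->
  (forall y, root (intpC g) y -> `|y| = 1) -> root (intpC g) x ->
  exists2 n, (0 < n)%N & x ^+ n = 1.
Proof.
move=> gm g1 gx; have [p [W [pm pE _]]] := int_minCpoly gm gx.
have [s sE] := closed_field_poly_normal (intpC p).
rewrite pE (monicP (minCpoly_monic x)) scale1r -pE in sE.
have p1 : (1 < size p)%N.
  by rewrite -(size_map_inj_poly (@intr_inj algC)) // pE size_minCpoly.
have s0 : (0 < size s)%N.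
  by move: p1; rewrite -(size_map_inj_poly (@intr_inj algC)) // sE size_prod_XsubC.
have conj y : y \in s -> root (minCpoly x) y.
  by rewrite -pE sE root_prod_XsubC.
have [|K K0 HK] := @circle_recurrence s 3 isT.
  by move=> y /conj xy; apply: g1; rewrite -(root_minCpoly_conj g xy).
exists K => //.
have [n [C chC]] := companion_ex pm p1; rewrite -chC in sE.
have XK y : (intpC ('X^K - 1)).[y] = y ^+ K - 1.
  by rewrite rmorphB /= map_polyXn rmorph1 hornerD hornerN hornerC hornerXn.
have := int_det_horner_mx_roots ('X^K - 1) sE.
under eq_bigr do rewrite XK.
move=> E; have : `|\det (horner_mx C ('X^K - 1))| < 1.
  rewrite -(ltr_int algC) intr_norm E normr_prod.
  apply: (@le_lt_trans _ _ (\prod_(y <- s) (2 / 3))).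
    rewrite big_seq [leRHS]big_seq; apply: ler_prod => y ys.
    by rewrite normr_ge0 ler_pdivlMr ?ltr0n // HK.
  rewrite prodr_const_seq exprn_ilt1 ?divr_ge0 // ?ltr_pdivrMr ?ltr0n // -?lt0n //.
  by rewrite mul1r ltr_nat.
move: (\det _) E => D E D1; have D0 : D = 0 by lia.
move: E; rewrite D0 => /esym/eqP.
rewrite prodf_seq_eq0 => /hasP[y ys /= y1].
have : root (intpC ('X^K - 1)) x.
  by rewrite (root_minCpoly_conj _ (conj y ys)) rootE XK.
by rewrite rootE XK subr_eq0 => /eqP.
Qed.

(** * Size of norms against divisibility *)

Lemma expr_unbounded (rho T : algC) : 1 < rho -> T \is Num.real ->
  exists B, forall n, (B < n)%N -> T < rho ^+ n.
Proof.
move=> rho1 Tr; have d0 : 0 < rho - 1 by rewrite subr_gt0.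
have bern n : (rho - 1) * n%:R < rho ^+ n.
  elim: n => [|n IH]; first by rewrite mulr0 expr0 ltr01.
  have rn : 1 <= rho ^+ n by rewrite exprn_ege1 // ltW.
  have -> : rho ^+ n.+1 = rho ^+ n + rho ^+ n * (rho - 1) by rewrite exprSr; ring.
  by rewrite -natr1 mulrDr mulr1 ltr_leD // ler_peMl // ltW.
exists (Num.bound (`|T| / (rho - 1))) => n Bn.
apply: le_lt_trans (bern n); rewrite (le_trans (real_ler_norm Tr)) //.
rewrite mulrC -ler_pdivrMr //.
apply: le_trans (ltW (archi_boundP _)) _; last by rewrite ler_nat ltnW.
by rewrite divr_ge0 // ltW.
Qed.

(* [g(t^a)] divides [g(t^b)] in the group rings [(Z/q)[Z/n]] for all [q >= 2]. *)
Definition pow_dvd (g : {poly int}) (n a b : nat) :=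
  forall k, exists Y Z : {poly 'Z_k.+2},
    map_poly intr (g \Po 'X^b) =
      Y * map_poly intr (g \Po 'X^a) + Z * map_poly intr ('X^n - 1).

Lemma comp_Xn_monic (R : idomainType) (p : {poly R}) (a : nat) : (0 < a)%N ->
  p \is monic -> p \Po 'X^a \is monic.
Proof.
by move=> a0 pm; rewrite monicE lead_coef_comp ?size_polyXn // lead_coefXn expr1n mulr1.
Qed.

(** One [n] serves all [a] and [b]: it is so large that the estimate of [norm_size_bound] fails for
    every [a <= A], which forces some [g(x^b)] to vanish. *)
Lemma pow_dvd_leq (g : {poly int}) (alpha : algC) (A n0 : nat) :
  g \is monic -> root (intpC g) alpha -> 1 < `|alpha| ->
  (forall y, root (intpC g) y -> `|y| <= `|alpha|) -> (0 < n0)%N ->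
  exists n, [/\ (A < n)%N, (n0 %| n)%N &
    forall a b, (0 < a <= A)%N -> (2 * (b * (size g).-1) <= n)%N ->
      pow_dvd g n a b -> (b <= a)%N].
Proof.
move=> gm ga alpha1 gmax n00.
have [p [W [pm pE gWp]]] := int_minCpoly gm ga.
have [G GE] := closed_field_poly_normal (intpC g).
have [s sE] := closed_field_poly_normal (intpC p).
have sizeC (q : {poly int}) : size (intpC q) = size q.
  by apply: size_map_inj_poly; [exact: intr_inj|].
rewrite (monicP (_ : intpC g \is monic)) ?monic_map // scale1r in GE.
rewrite pE (monicP (minCpoly_monic _)) scale1r -pE in sE.
have szG : size G = (size g).-1 by rewrite -sizeC GE size_prod_XsubC.
have Groot z : (z \in G) = root (intpC g) z by rewrite GE root_prod_XsubC.
have sroot y : (y \in s) = root (minCpoly alpha) y by rewrite -pE sE root_prod_XsubC.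
have XnE y m : (intpC ('X^m - 1)).[y] = y ^+ m - 1.
  by rewrite rmorphB /= map_polyXn rmorph1 hornerD hornerN hornerC hornerXn.
have sN1 : {in s, forall y k, (0 < k)%N -> y ^+ k != 1}.
  move=> y; rewrite sroot => ay k k0; apply/eqP => yk1.
  have : root (intpC ('X^k - 1)) y by rewrite rootE XnE yk1 subrr.
  rewrite -(root_minCpoly_conj _ ay) rootE XnE.
  rewrite subr_eq0 => /eqP/(congr1 Num.norm)/eqP.
  by rewrite normrX normr1 gt_eqF // exprn_egt1 // -lt0n.
have [c c0 Hc] := powers_away_from_one n00 sN1.
set rho := `|alpha| in alpha1 gmax.
have rho0 : 0 < rho := lt_trans ltr01 alpha1.
pose E := 1 + A%:R / c * (2 * rho) ^+ size G.
have E1 : 1 <= E.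
  by rewrite lerDl mulr_ge0 ?exprn_ge0 ?divr_ge0 ?mulr_ge0 ?ler0n // ltW.
(* The exponent dominates [2 * a * size X], because [size X = a * size s] and [a <= A]. *)
have [|B HB] := @expr_unbounded rho (E ^+ (2 * A * (A * size s))) alpha1.
  by rewrite rpredX // ger0_real // (le_trans ler01).
have [n [nB n0n Hn]] := Hc (maxn A B).
exists n; split=> // [|a b /andP[a0 aA]]; first exact: leq_ltn_trans (leq_maxl _ _) nB.
rewrite -szG => bn dv.
have {}HB : E ^+ (2 * A * (A * size s)) < rho ^+ n.
  by apply/HB; apply: leq_ltn_trans nB; apply: leq_maxr.
(* Its roots [X] are the [a]-th roots of the conjugates of [alpha]. *)
pose P := p \Po 'X^a.
have Pm : P \is monic := comp_Xn_monic a0 pm.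
have [X XE] := closed_field_poly_normal (intpC P).
rewrite (monicP (_ : intpC P \is monic)) ?monic_map // scale1r in XE.
have compC (q : {poly int}) e x : (intpC (q \Po 'X^e)).[x] = (intpC q).[x ^+ e].
  by rewrite map_comp_poly map_polyXn horner_comp hornerXn.
have Xs x : (x \in X) = (x ^+ a \in s).
  by rewrite -!root_prod_XsubC -sE -XE !rootE compC.
have szX : size X = (a * size s)%N.
  have HP : size P = (size X).+1 by rewrite -sizeC XE size_prod_XsubC.
  have Hp : size p = (size s).+1 by rewrite -sizeC sE size_prod_XsubC.
  have := size_comp_poly p 'X^a; rewrite -/P size_polyXn Hp HP /= => ->.
  by rewrite mulnC.
pose x0 := a.-root alpha.
have x0a : x0 ^+ a = alpha by rewrite rootCK.
have x0X : x0 \in X by rewrite Xs x0a sroot root_minCpoly.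
have P1 : (1 < size P)%N.
  by rewrite -sizeC XE size_prod_XsubC ltnS; case: (X) x0X.
have gz x : (intpC (g \Po 'X^b)).[x] = \prod_(z <- G) (x ^+ b - z).
  by rewrite compC GE horner_prod; under eq_bigr do rewrite hornerXsubC.
(* A zero factor yields [alpha ^+ b = z' ^+ a] with [z'] a root of [g], hence [b <= a]; a nonzero
   product contradicts the choice of [n]. *)
case: (eqVneq (\prod_(x <- X) (intpC (g \Po 'X^b)).[x]) 0) => [/eqP|nz].
  rewrite prodf_seq_eq0 => /hasP[x xX /=]; rewrite gz prodf_seq_eq0.
  move=> /hasP[z zG /=]; rewrite subr_eq0 => /eqP xz.
  have [||z' z'G] := @conjugate_power_relation g G a b alpha (x ^+ a) z gm GE _ zG.
  - by rewrite -sroot -Xs.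
  - by rewrite -xz -!exprM mulnC.
  move=> /(congr1 Num.norm); rewrite !normrX => az'.
  rewrite -(ler_eXn2l alpha1) az' lerXn2r ?nnegrE ?normr_ge0 ?(ltW rho0) //.
  by apply: gmax; rewrite -Groot.
have := @norm_prod_le P (g \Po 'X^a) (g \Po 'X^b) ('X^n - 1) X Pm P1 XE.
have Hdv : exists W0, g \Po 'X^a = W0 * P.
  by exists (W \Po 'X^a); rewrite gWp comp_polyM.
move=> /(_ Hdv dv).
have n'0 : (0 < n)%N by apply: leq_ltn_trans nB.
have nz' : \prod_(x <- X) (intpC ('X^n - 1)).[x] != 0.
  rewrite prodf_seq_neq0; apply/allP => x xX /=; rewrite XnE subr_eq0.
  apply/eqP => xn1; have := sN1 (x ^+ a); rewrite -Xs => /(_ xX n n'0).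
  by rewrite -exprM mulnC exprM xn1 expr1n eqxx.
move=> /(_ nz' nz).
under eq_bigr do rewrite XnE.
under [leRHS]eq_bigr do rewrite gz normr_prod.
have Grho : {in G, forall z, `|z| <= rho} by move=> z; rewrite Groot; exact: gmax.
have xrho : `|x0| ^+ a = rho by rewrite -normrX x0a.
have Xlow : {in X, forall x, c / a%:R * max1 x ^+ n <= `|x ^+ n - 1|}.
  by move=> x; rewrite Xs => /Hn; apply: root_power_away.
have aA' : (0 < a <= A)%N by rewrite a0.
move=> /(norm_size_bound (ltW alpha1) c0 aA' bn Grho x0X xrho Xlow) le.
have := lt_le_trans HB le.
rewrite szX real_ltNge ?ger0_real ?exprn_ge0 ?(le_trans ler01) //.
by rewrite ler_weXn2l // leq_mul // ?leq_mul2l ?aA ?orbT // leq_mul2r aA orbT.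
Qed.

(** * From ideals to congruences modulo [t^n - 1] *)

Definition palindromic (g : {poly int}) :=
  forall i, (i < size g)%N -> g`_((size g).-1 - i) = g`_i.

(** The symmetry of the coefficients under [k -> N - k] confines the exponents to the range from
    [e = N - d] to [d]. The identity [f = t^e g] is stated for arbitrary [phi] because it is
    evaluated both in group rings and in [algC]. *)
Lemma laurent_normal_form (f : laurent) :
  laurent_monic f -> laurent_reciprocal f ->
  exists (g : {poly int}) (e : int), [/\ g \is monic, palindromic g
    & forall (V : zmodType) (phi : int -> V),
        \sum_(k <- msupp f) phi k *~ f@_k =
        \sum_(i < size g) phi (e + i%:Z) *~ g`_i].
Proof.
move=> [d [fd fgt]] [N fN].
have fsym k : f@_k = f@_(N - k).
  rewrite {1}fN raddf_sum /=.
  have jE j : (N - j == k) = (j == N - k) by apply/eqP/eqP; lia.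
  under eq_bigr => j _ do rewrite mcoeffU mulrb jE.
  rewrite -big_mkcond /=; have [kf|kf] := boolP (N - k \in msupp f).
    rewrite big_mkcond (bigD1_seq (N - k)) ?fset_uniq //= eqxx big1 ?addr0 //.
    by move=> j /negPf ->.
  rewrite mcoeff_outdom // big_seq_cond big1 // => j /andP[jf /eqP jN].
  by rewrite -jN jf in kf.
have fNd : f@_(N - d) = 1 by rewrite -fsym.
have flt k : k < N - d -> f@_k = 0.
  by move=> lt; rewrite fsym fgt // ltrBrDl -ltrBrDr.
have led : N - d <= d.
  by rewrite leNgt; apply/negP => /fgt; rewrite fNd => /eqP.
have [r rE] : exists r : nat, d = N - d + r%:Z.
  by exists (absz (d - (N - d))%R); lia.
pose g := \poly_(i < r.+1) f@_(N - d + i%:Z).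
have szg : size g = r.+1 by rewrite size_poly_eq //= -rE fd.
have gE i : g`_i = f@_(N - d + i%:Z).
  by rewrite coef_poly; case: ltnP => // ri; rewrite fgt //; lia.
exists g, (N - d); split.
- by rewrite monicE lead_coefE szg gE -rE fd.
- move=> i; rewrite szg ltnS /= => ir; rewrite !gE fsym; congr (f@__); lia.
move=> V phi; rewrite szg.
under [RHS]eq_bigr do rewrite gE.
pose F k := phi k *~ f@_k.
rewrite -[LHS]/(\sum_(k <- msupp f) F k) -[RHS]/(\sum_(i < r.+1) F (N - d + i%:Z)).
rewrite -(big_mkord xpredT (fun i => F (N - d + i%:Z))).
rewrite -(big_map (fun i : nat => N - d + i%:Z) xpredT F).
set s := map _ _.
have s_uniq : uniq s.
  by rewrite map_inj_uniq ?iota_uniq // => i j; lia.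
rewrite [RHS](bigID (fun k => k \in msupp f)) /= [X in _ + X]big1 ?addr0; last first.
  by move=> k; rewrite /F -mcoeff_eq0 => /eqP ->; rewrite mulr0z.
rewrite -[RHS]big_filter; apply: perm_big; apply: uniq_perm.
- exact: fset_uniq.
- by rewrite filter_uniq.
move=> k; rewrite mem_filter; case: (boolP (k \in msupp f)) => //= kf.
symmetry; apply/mapP; exists (absz (k - (N - d))%R).
  rewrite mem_index_iota /=.
  have : ~ d < k by move=> /fgt /eqP; rewrite mcoeff_eq0 kf.
  have : ~ k < N - d by move=> /flt /eqP; rewrite mcoeff_eq0 kf.
  lia.
have : ~ k < N - d by move=> /flt /eqP; rewrite mcoeff_eq0 kf.
lia.
Qed.

Definition Xn1_cong (R : comNzRingType) (n : nat) (x y : {poly R}) :=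
  exists Z, x = y + Z * ('X^n - 1).

Section Congruence.
Variables (R : comNzRingType) (n : nat).
Implicit Types x y z t : {poly R}.
Local Notation cong := (@Xn1_cong R n).

Lemma cong_refl x : cong x x.
Proof. by exists 0; rewrite mul0r addr0. Qed.

Lemma cong_sym x y : cong x y -> cong y x.
Proof. by move=> [Z ->]; exists (- Z); ring. Qed.

Lemma cong_trans y x z : cong x y -> cong y z -> cong x z.
Proof. by move=> [Z ->] [Z' ->]; exists (Z + Z'); ring. Qed.

Lemma congM x y z t : cong x y -> cong z t -> cong (x * z) (y * t).
Proof.
move=> [Z ->] [Z' ->]; exists (Z * t + y * Z' + Z * Z' * ('X^n - 1)); ring.
Qed.

Lemma cong_sum (I : Type) (r : seq I) (F G : I -> {poly R}) :
  (forall i, cong (F i) (G i)) -> cong (\sum_(i <- r) F i) (\sum_(i <- r) G i).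
Proof.
move=> FG; elim: r => [|i r [Z IH]]; first by rewrite !big_nil; apply: cong_refl.
rewrite !big_cons IH; have [Z' ->] := FG i; exists (Z' + Z); ring.
Qed.

Lemma cong_Xn i j : i = j %[mod n] -> cong 'X^i 'X^j.
Proof.
have red k : cong 'X^k 'X^(k %% n).
  rewrite {1}(divn_eq k n) addnC exprD mulnC exprM.
  exists ('X^(k %% n) * \sum_(i < k %/ n) ('X^n) ^+ i).
  by rewrite -mulrA [_ * ('X^n - 1)]mulrC -subrX1; ring.
by move=> ij; apply: cong_trans (red i) _; rewrite ij; apply/cong_sym/red.
Qed.

End Congruence.

Section GroupRingLift.
Variables (q n a : nat).
Local Notation Zq := 'Z_q.+2.
Local Notation cong := (@Xn1_cong Zq n.+2).

(* [sum_h u_h h] is sent to [sum_h u_h t^(a h)], with [h] between [0] and [n + 1];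
   this is multiplicative modulo [t^(n+2) - 1] only. *)
Definition lift (u : grpring Zq 'Z_n.+2) : {poly Zq} :=
  \sum_(h : 'Z_n.+2) u h *: 'X^(a * h).

Lemma lift_gelt h : lift (gelt Zq h) = 'X^(a * h).
Proof.
rewrite /lift (bigD1 h) //= big1 ?addr0 ?ffunE ?eqxx ?scale1r // => j /negPf jh.
by rewrite ffunE jh scale0r.
Qed.

Fact lift_zmod_morphism : zmod_morphism lift.
Proof.
move=> u v; rewrite /lift -sumrB; apply: eq_bigr => h _.
by rewrite !ffunE scalerBl.
Qed.

HB.instance Definition _ := GRing.isZmodMorphism.Build
  (grpring Zq 'Z_n.+2) {poly Zq} lift lift_zmod_morphism.

Lemma liftM u v : cong (lift (u * v)) (lift u * lift v).
Proof.
apply: cong_sym; rewrite /lift mulr_suml.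
under eq_bigr do rewrite mulr_sumr.
have -> : \sum_(h : 'Z_n.+2) (u * v) h *: ('X^(a * h) : {poly Zq}) =
    \sum_(h : 'Z_n.+2) \sum_(k : 'Z_n.+2) (u h * v k) *: 'X^(a * (h + k)%R).
  rewrite [RHS](eq_bigr (fun h => \sum_(k : 'Z_n.+2) (u h * v (k - h)) *: 'X^(a * k))).
    rewrite exchange_big; apply: eq_bigr => k _ /=.
    by rewrite ffunE scaler_suml.
  move=> h _; rewrite [RHS](reindex_inj (addrI h)) /=.
  by apply: eq_bigr => k _; rewrite addrAC subrr add0r.
apply: cong_sum => h; apply: cong_sum => k.
rewrite -scalerAl -scalerAr scalerA -!mul_polyC -exprD -mulnDr.
apply: congM; first exact: cong_refl.
by apply: cong_Xn; rewrite /= modnMmr.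
Qed.

End GroupRingLift.

Lemma geltD (R : comNzRingType) (G : finZmodType) (g h : G) :
  gelt R (g + h) = gelt R g * gelt R h.
Proof.
apply/ffunP => k; rewrite !ffunE (bigD1 g) //= big1 ?addr0.
  by rewrite !ffunE eqxx mul1r subr_eq addrC.
by move=> j /negPf jg; rewrite ffunE jg mul0r.
Qed.

Fact proj_zmod_morphism (S : inv_system) (i : idx S) : zmod_morphism (@proj S i).
Proof. by []. Qed.

HB.instance Definition _ (S : inv_system) (i : idx S) :=
  GRing.isZmodMorphism.Build (invlim S) (obj i) (@proj S i)
    (@proj_zmod_morphism S i).

Fact proj_monoid_morphism (S : inv_system) (i : idx S) :
  monoid_morphism (@proj S i).
Proof. by []. Qed.

HB.instance Definition _ (S : inv_system) (i : idx S) :=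
  GRing.isMonoidMorphism.Build (invlim S) (obj i) (@proj S i)
    (@proj_monoid_morphism S i).

Section Evaluation.
Variables (f : laurent) (mu : Zhat) (g : {poly int}) (e : int).
Hypothesis fg : forall (V : zmodType) (phi : int -> V),
  \sum_(k <- msupp f) phi k *~ f@_k = \sum_(i < size g) phi (e + i%:Z) *~ g`_i.
Variables (q n : nat).

Definition grp_eval (u : 'Z_n.+2) : grpring 'Z_q.+2 'Z_n.+2 :=
  \sum_(i < size g) gelt 'Z_q.+2 (u *+ i) *~ g`_i.

(** The first factor is a group element, hence invertible: ideals do not see the shift by [e]. *)
Lemma proj_laurent_at :
  proj (S := ZhatZhat_system) (q, n) (laurent_at f mu) =
  gelt 'Z_q.+2 (proj (S := Zhat_system) n mu *~ e) *
    grp_eval (proj (S := Zhat_system) n mu).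
Proof.
rewrite /laurent_at raddf_sum /=.
set u := proj _ mu.
transitivity (\sum_(k <- msupp f) gelt 'Z_q.+2 (u *~ k : 'Z_n.+2) *~ f@_k).
  apply: eq_bigr => k _; rewrite raddfMz; congr (_ *~ _).
  transitivity (gelt 'Z_q.+2 (proj (S := Zhat_system) n (mu *~ k) : 'Z_n.+2)).
    by [].
  by congr (gelt _ _); rewrite (raddfMz (@proj Zhat_system n) k mu).
rewrite (fg (fun k => gelt 'Z_q.+2 (u *~ k : 'Z_n.+2))) mulr_sumr.
by apply: eq_bigr => i _; rewrite mulrzDr geltD mulrzAr.
Qed.

Lemma lift_grp_eval (a b : nat) (u : 'Z_n.+2) : (b = a * u %[mod n.+2])%N ->
  Xn1_cong n.+2 (lift a (grp_eval u)) (map_poly intr (g \Po 'X^b)).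
Proof.
move=> bau; rewrite /grp_eval raddf_sum /=.
rewrite comp_polyE rmorph_sum /=.
apply: cong_sum => i.
have -> : lift a (gelt 'Z_q.+2 (u *+ i) *~ g`_i) = 'X^(a * (u *+ i)%R) *~ g`_i.
  by rewrite (raddfMz (lift a)) /= lift_gelt.
rewrite -mulrzl map_polyZ -exprM map_polyXn.
rewrite -mul_polyC rmorph_int; apply: congM; first exact: cong_refl.
by apply: cong_Xn; rewrite Zp_mulrn /= modnMmr mulnA -modnMml -bau modnMml.
Qed.

End Evaluation.

(** The relation [f(t^nu) = y f(t^mu)] is projected to a finite level, freed of its invertible
    monomials, and carried to polynomials by the substitution of [t^a] for [t]. *)
Lemma ideal_pow_dvd (f : laurent) (mu nu : Zhat) (g : {poly int}) (e : int)
    (n a b b' : nat) :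
  (forall (V : zmodType) (phi : int -> V), \sum_(k <- msupp f) phi k *~ f@_k =
     \sum_(i < size g) phi (e + i%:Z) *~ g`_i) ->
  principal_ideal (laurent_at f mu) (laurent_at f nu) ->
  b = a * (proj (S := Zhat_system) n nu : 'Z_n.+2) %[mod n.+2] ->
  b' = a * (proj (S := Zhat_system) n mu : 'Z_n.+2) %[mod n.+2] ->
  pow_dvd g n.+2 b' b.
Proof.
move=> fg [y _ yE] bE b'E k.
pose S := @grp_eval g k n.
pose u : 'Z_n.+2 := proj (S := Zhat_system) n nu.
pose v : 'Z_n.+2 := proj (S := Zhat_system) n mu.
pose w : grpring 'Z_k.+2 'Z_n.+2 := proj (S := ZhatZhat_system) (k, n) y.
have E : w * (gelt _ (v *~ e) * S v) = gelt _ (u *~ e) * S u.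
  by rewrite -(proj_laurent_at mu fg k n) -(proj_laurent_at nu fg k n) -yE.
pose c := gelt 'Z_k.+2 (- (u *~ e)) * w * gelt 'Z_k.+2 (v *~ e).
have {}E : S u = c * S v.
  by rewrite /c -!mulrA E mulrA -geltD addNr; rewrite -[LHS]mul1r.
have [Z ZE] : Xn1_cong n.+2 (map_poly intr (g \Po 'X^b))
    (lift a c * map_poly intr (g \Po 'X^b')).
  apply: cong_trans (cong_sym (lift_grp_eval g k bE)) _.
  rewrite -/u -/(S u) E; apply: cong_trans (liftM _ _ _) _.
  by apply: congM; [exact: cong_refl|exact: lift_grp_eval].
by exists (lift a c), Z; rewrite ZE rmorphB /= map_polyXn rmorph1.
Qed.

(** * Reflection of exponents *)

(** Modulo [t^n - 1], [t^(n - b)] is the inverse of [t^b], and [x^r g(1/x) = g(x)] for a palindromic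
    [g] of degree [r]. *)
Lemma palindromic_reflect (R : comNzRingType) (g : {poly int}) (n b : nat) :
  palindromic g -> (b <= n)%N ->
  Xn1_cong n ('X^(b * (size g).-1) * map_poly intr (g \Po 'X^(n - b)))
    (map_poly intr (g \Po 'X^b) : {poly R}).
Proof.
move=> gpal bn.
have expand d : map_poly intr (g \Po 'X^d) =
    \sum_(i < size g) (g`_i)%:~R%:P * 'X^(d * i) :> {poly R}.
  rewrite comp_polyE rmorph_sum; apply: eq_bigr => i _ /=.
  by rewrite map_polyZ -exprM map_polyXn mul_polyC.
rewrite !expand mulr_sumr [X in Xn1_cong _ _ X](reindex_inj rev_ord_inj) /=.
apply: cong_sum => i; rewrite mulrCA.
have -> : (size g - i.+1 = (size g).-1 - i)%N by lia.
rewrite gpal //; apply: congM; first exact: cong_refl.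
rewrite -exprD; apply: cong_Xn.
have -> : (b * (size g).-1 + (n - b) * i = b * ((size g).-1 - i) + i * n)%N.
  have ig : (i <= (size g).-1)%N by rewrite -ltnS (ltn_predK (ltn_ord i)).
  have bi : (b * i <= b * (size g).-1)%N by rewrite leq_mul2l ig orbT.
  have ni : (b * i <= n * i)%N by rewrite leq_mul2r bn orbT.
  rewrite mulnBl mulnBr [(i * n)%N]mulnC; move: bi ni.
  by move: (b * _)%N (b * i)%N (n * i)%N => x y z; lia.
by rewrite addnC modnMDl.
Qed.

Lemma pow_dvd_cong (g : {poly int}) (n a b : nat) : pow_dvd g n a b <->
  forall k, exists Y, Xn1_cong n (map_poly intr (g \Po 'X^b))
    (Y * map_poly intr (g \Po 'X^a) : {poly 'Z_k.+2}).
Proof.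
have E k : map_poly intr ('X^n - 1) = 'X^n - 1 :> {poly 'Z_k.+2}.
  by rewrite rmorphB /= map_polyXn rmorph1.
split=> dv k; first by have [Y [Z YZ]] := dv k; exists Y, Z; rewrite YZ E.
by have [Y [Z YZ]] := dv k; exists Y, Z; rewrite YZ E.
Qed.

(** This and the next lemma absorb the sign when [a mu = - b] modulo [n]. *)
Lemma pow_dvd_reflect_r (g : {poly int}) (n a b : nat) :
  palindromic g -> (b <= n)%N -> pow_dvd g n a (n - b) -> pow_dvd g n a b.
Proof.
move=> gpal bn /pow_dvd_cong dv; apply/pow_dvd_cong => k; have [Y YE] := dv k.
exists ('X^(b * (size g).-1) * Y).
apply: cong_trans (cong_sym (palindromic_reflect _ gpal bn)) _.
by rewrite -mulrA; apply: congM YE; exact: cong_refl.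
Qed.

Lemma pow_dvd_reflect_l (g : {poly int}) (n a b : nat) :
  palindromic g -> (b <= n)%N -> pow_dvd g n (n - b) a -> pow_dvd g n b a.
Proof.
move=> gpal bn /pow_dvd_cong dv; apply/pow_dvd_cong => k; have [Y YE] := dv k.
exists (Y * 'X^((n - b) * (size g).-1)); apply: cong_trans YE _.
rewrite -mulrA; apply: congM; first exact: cong_refl.
apply: cong_sym; have := palindromic_reflect 'Z_k.+2 gpal (leq_subr b n).
by rewrite subKn.
Qed.

(** * Small multiples and torsion in [Zhat] *)

(** Among the residues of [0, m, ..., A * m], two share one of [A] slots of length [n / A]. Their
    difference is the multiple sought; the sign depends on which residue is larger. *)
Lemma small_multiple (m n A : nat) : (0 < A)%N -> (0 < n)%N ->
  exists a b, [/\ (0 < a <= A)%N, (A * b <= n)%N &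
    b = a * m %[mod n] \/ (n - b)%N = a * m %[mod n]].
Proof.
move=> A0 n0; pose v k := ((k * m) %% n)%N.
have vn k : (v k < n)%N by rewrite ltn_pmod.
have slot k : (v k * A %/ n < A)%N by rewrite ltn_divLR // mulnC ltn_pmul2l.
pose F (k : 'I_A.+1) : 'I_A := Ordinal (slot k).
have /injectivePn[k1 [k2 k12 /(congr1 val) /= Fk]] : ~~ injectiveb F.
  by apply/negP => /injectiveP/leq_card; rewrite !card_ord ltnn.
wlog lt : k1 k2 k12 Fk / (k1 < k2)%N.
  move=> H; case: (ltngtP k1 k2) => [|lt|/val_inj/eqP]; first exact: H.
    by apply: (H k2 k1); rewrite // 1?eq_sym.
  by rewrite (negPf k12).
have k2A := ltn_ord k2.
have a0 : (0 < k2 - k1 <= A)%N by lia.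
have e1 := divn_eq (v k1 * A) n; have e2 := divn_eq (v k2 * A) n.
have l1 := ltn_pmod (v k1 * A) n0; have l2 := ltn_pmod (v k2 * A) n0.
rewrite Fk in e1.
have k21 : ((k2 - k1) * m + k1 * m = k2 * m)%N by rewrite -mulnDl subnK // ltnW.
case: (leqP (v k1) (v k2)) => v12.
  exists (k2 - k1)%N, (v k2 - v k1)%N; split=> //; first by nia.
  left; apply/eqP; rewrite -(eqn_modDr (k1 * m)) k21 -modnDmr subnK //.
  by rewrite /v modn_mod.
exists (k2 - k1)%N, (v k1 - v k2)%N; split=> //; first by nia.
right; apply/eqP; rewrite -(eqn_modDr (k1 * m)) k21 -modnDmr -/(v k1).
have -> : (n - (v k1 - v k2) + v k1 = v k2 + n)%N by have := vn k1; lia.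
by rewrite modnDr /v modn_mod.
Qed.

(** The component modulo [k.+2] is read off the one modulo [N * k.+2], where being killed by [N]
    means being divisible by [k.+2]. *)
Lemma Zhat_torsion_free (x : Zhat) (N : nat) : (0 < N)%N -> x *+ N = 0 -> x = 0.
Proof.
move=> N0 xN; apply: invlimP => k.
have [K KE] : exists K, K.+2 = (N * k.+2)%N by exists (N * k.+2).-2; lia.
have h : (k.+2 %| K.+2)%N by rewrite KE dvdn_mull.
pose w : 'Z_K.+2 := proj (S := Zhat_system) K x.
have wN : w *+ N = 0.
  have := raddfMn (@proj Zhat_system K) N x.
  by rewrite xN raddf0.
rewrite -(proj_tr (S := Zhat_system) (i := k) (j := K) h x) -[LHS]/(Zred h w).
move: w wN => w /(congr1 val); rewrite Zp_mulrn /= => /eqP wN.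
have kw : (k.+2 %| w)%N by rewrite -(dvdn_pmul2l N0) -KE mulnC.
by apply: val_inj; rewrite /= val_Zp_nat //; apply/eqP.
Qed.

(** The alternative may vary with the modulus. If the first one fails at [k1], it fails at all
    multiples of [k1.+2], so the second one holds there and hence at every modulus. *)
Lemma Zhat_eq_pm1 (mu : Zhat) (N : nat) : (0 < N)%N ->
  (forall k, exists2 n, (k.+2 %| n.+2)%N &
     proj (S := Zhat_system) n ((mu - 1) *+ N) = 0 \/
     proj (S := Zhat_system) n ((mu + 1) *+ N) = 0) ->
  mu = 1 \/ mu = - 1.
Proof.
move=> N0 H.
have down (x : Zhat) k n : (k.+2 %| n.+2)%N ->
    proj (S := Zhat_system) n x = 0 -> proj (S := Zhat_system) k x = 0.
  by move=> h xn; rewrite -(proj_tr (S := Zhat_system) (i := k) (j := n) h x) xn raddf0.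
have {}H k : proj (S := Zhat_system) k ((mu - 1) *+ N) = 0 \/
             proj (S := Zhat_system) k ((mu + 1) *+ N) = 0.
  by have [n h [x0|x0]] := H k; [left|right]; apply: down h x0.
have [all0|] := pselect (forall k, proj (S := Zhat_system) k ((mu - 1) *+ N) = 0).
  left; apply/eqP; rewrite -subr_eq0; apply/eqP/(Zhat_torsion_free N0).
  exact: invlimP.
move/existsNP => [k1 k1N]; right; apply/eqP; rewrite -addr_eq0; apply/eqP.
apply/(Zhat_torsion_free N0)/invlimP => k.
have [K KE] : exists K, K.+2 = (k1.+2 * k.+2)%N by exists (k1.+2 * k.+2).-2; lia.
case: (H K) => [K0|]; last by apply: down; rewrite KE dvdn_mull.
by case: k1N; apply: down K0; rewrite KE dvdn_mulr.
Qed.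

(** * Conclusion of the proof *)

Lemma unit_eq_pm1_of_large_root (f : laurent) (mu : Zhat) (g : {poly int}) (e : int)
    (alpha : algC) :
  (forall (V : zmodType) (phi : int -> V), \sum_(k <- msupp f) phi k *~ f@_k =
     \sum_(i < size g) phi (e + i%:Z) *~ g`_i) ->
  g \is monic -> palindromic g -> mu \is a GRing.unit ->
  principal_ideal (laurent_at f 1) = principal_ideal (laurent_at f mu) ->
  root (intpC g) alpha -> 1 < `|alpha| ->
  (forall y, root (intpC g) y -> `|y| <= `|alpha|) -> mu = 1 \/ mu = - 1.
Proof.
move=> fg gm gpal muU idE ga alpha1 gmax.
have memE nu : principal_ideal (laurent_at f nu) (laurent_at f nu).
  by exists 1; rewrite ?mul1r.
have mu1 : principal_ideal (laurent_at f mu) (laurent_at f 1) by rewrite -idE.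
have one_mu : principal_ideal (laurent_at f 1) (laurent_at f mu) by rewrite idE.
pose r := (size g).-1.
have r0 : (0 < r)%N.
  have : (1 < size (intpC g))%N.
    by apply: root_size_gt1 ga; rewrite monic_neq0 // monic_map.
  rewrite size_map_inj_poly ?rmorph0 //; last exact: intr_inj.
  by rewrite /r; case: (size g) => [|[|]].
pose A := (2 * r)%N; have A0 : (0 < A)%N by rewrite /A; lia.
(* The multiplier [a <= A] found below depends on the modulus, but it always divides [A!]. *)
apply: (Zhat_eq_pm1 (fact_gt0 A)) => k.
(* [A * A < N] ensures [2 * (a * r) <= N] for [a <= A], which is needed once the roles of [a] and
   [b] are exchanged. *)
have [N [AN kN dvN]] := pow_dvd_leq (A * A) gm ga alpha1 gmax (ltn0Sn k.+1).
have A2N : (A < N)%N by apply: leq_ltn_trans AN; rewrite leq_pmulr.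
have [n nE] : exists n, N = n.+2 by exists N.-2; lia.
rewrite {N}nE in AN kN dvN A2N.
exists n => //.
set u := proj (S := Zhat_system) n mu.
pose m : nat := (u : 'Z_n.+2).
have m_cop : coprime n.+2 m.
  rewrite -(unitZpE m (isT : (1 < n.+2)%N)) natr_Zp.
  apply/unitrPr; exists (proj (S := Zhat_system) n mu^-1 : 'Z_n.+2).
  exact: (congr1 (proj (S := Zhat_system) n) (divrr muU)).
have [a [b [/andP[a0 aA] bn abm]]] := small_multiple m A0 (ltn0Sn n.+1).
have bn' : (2 * (b * r) <= n.+2)%N by rewrite mulnCA mulnC.
have {dvN}dvA a' b' : (0 < a' <= A)%N -> (2 * (b' * r) <= n.+2)%N ->
    pow_dvd g n.+2 a' b' -> (b' <= a')%N.
  move=> /andP[a'0 a'A]; apply: dvN; rewrite a'0 /=.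
  by rewrite (leq_trans a'A) // leq_pmulr.
have bn2 : (b <= n.+2)%N by apply: leq_trans bn; rewrite leq_pmull.
have a1 : a = a * (proj (S := Zhat_system) n 1 : 'Z_n.+2) %[mod n.+2].
  by rewrite muln1.
(* If [b = 0], then [n.+2] divides [a * m], hence [a], since [m] is a unit; but
   [0 < a <= A < n.+2]. *)
have b0 : (0 < b)%N.
  rewrite lt0n; apply/eqP => b0.
  have : (n.+2 %| a * m)%N.
    by case: abm => abm; rewrite /dvdn -abm b0 ?subn0 ?mod0n ?modnn.
  rewrite Gauss_dvdl // => /(dvdn_leq a0).
  by rewrite leqNgt (leq_ltn_trans aA).
(* Each inclusion of ideals gives one of the two divisibilities. *)
have [dv1 dv2] : pow_dvd g n.+2 a b /\ pow_dvd g n.+2 b a.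
  case: abm => abm.
    split; first exact: (ideal_pow_dvd fg one_mu abm a1).
    exact: (ideal_pow_dvd fg mu1 a1 abm).
  split; [apply: pow_dvd_reflect_r => //|apply: pow_dvd_reflect_l => //].
    exact: (ideal_pow_dvd fg one_mu abm a1).
  exact: (ideal_pow_dvd fg mu1 a1 abm).
have ba : (b <= a)%N by apply: dvA; rewrite ?a0.
have ab : (a <= b)%N.
  apply: dvA dv2; first by rewrite b0 (leq_trans ba).
  by apply: leq_trans (ltnW AN); rewrite mulnCA mulnC leq_mul.
have {ab ba}abE : a = b by apply/eqP; rewrite eqn_leq ab.
have [t tE] : exists t, (A`! = a * t)%N.
  have /dvdnP[t ->] : (a %| A`!)%N by apply: dvdn_fact; rewrite a0.
  by exists t; rewrite mulnC.
have natE i j : i = j %[mod n.+2] -> i%:R = j%:R :> 'Z_n.+2.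
  by move=> ij; apply: val_inj; rewrite /= !val_Zp_nat.
have uE : u = m%:R :> 'Z_n.+2 by rewrite natr_Zp.
have projMn (x : Zhat) : proj (S := Zhat_system) n (x *+ A`!) =
    (proj (S := Zhat_system) n x : 'Z_n.+2) *+ a *+ t.
  by rewrite (raddfMn (@proj Zhat_system n)) tE mulrnA.
case: abm => /natE abm; [left|right]; rewrite projMn.
  have -> : proj (S := Zhat_system) n (mu - 1) = m%:R - 1 :> 'Z_n.+2.
    by rewrite -uE.
  by rewrite mulrnBl -mulrnA mulnC -abm -abE subrr mul0rn.
have -> : proj (S := Zhat_system) n (mu + 1) = m%:R + 1 :> 'Z_n.+2.
  by rewrite -uE.
(* Here [a * m + a = (n.+2 - a) + a], which is 0 modulo [n.+2]. *)
rewrite mulrnDl -mulrnA mulnC -abm -abE -natrD subnK ?abE //.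
by rewrite pchar_Zp // mul0rn.
Qed.

Theorem theorem1p2 (f : laurent) (mu : Zhat) :
  laurent_monic f -> laurent_reciprocal f ->
  mu \is a GRing.unit ->
  principal_ideal (laurent_at f 1) = principal_ideal (laurent_at f mu) ->
  (mu = 1 \/ mu = - 1) \/
  (forall x : algC, laurent_root f x ->
     exists n : nat, (0 < n)%N /\ n.-unity_root x).
Proof.
move=> fm fr muU idE.
have [g [e [gm gpal fg]]] := laurent_normal_form fm fr.
have g0 : g != 0 by rewrite monic_neq0.
have g_0 : g`_0 = 1.
  have sg : (0 < size g)%N by rewrite size_poly_gt0.
  by rewrite -(gpal 0%N sg) subn0 -lead_coefE (monicP gm).
have gE y : (intpC g).[y] = \sum_(i < size g) y ^+ i *~ g`_i.
  rewrite (horner_coef_wide (n := size g)); last first.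
    by rewrite size_map_inj_poly ?rmorph0 //; exact: intr_inj.
  by apply: eq_bigr => i _; rewrite coef_map /= mulrzl.
have root_neq0 y : root (intpC g) y -> y != 0.
  apply: contraTneq => ->; rewrite rootE horner_coef0 coef_map g_0 /=.
  exact: oner_neq0.
(* Reversing the order of summation gives [y^r g(1/y) = g(y)], with [r] the degree of [g]. *)
have root_inv y : root (intpC g) y -> root (intpC g) y^-1.
  move=> gy; have y0 := root_neq0 y gy; move: gy; rewrite !rootE => /eqP gy.
  apply/eqP/(mulfI (expf_neq0 (size g).-1 y0)).
  rewrite mulr0 -{}gy !gE mulr_sumr [LHS](reindex_inj rev_ord_inj) /=.
  apply: eq_bigr => i _.
  have ig : (i <= (size g).-1)%N by rewrite -ltnS (ltn_predK (ltn_ord i)).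
  have -> : (size g - i.+1 = (size g).-1 - i)%N by rewrite -subn1 subnAC subn1 subnS.
  rewrite gpal // mulrzAr exprVn; congr (_ *~ _).
  by rewrite -[X in _ ^+ X * _](subnKC ig) exprD mulfK ?expf_neq0.
have [G GE] := closed_field_poly_normal (intpC g).
rewrite (monicP (_ : intpC g \is monic)) ?monic_map // scale1r in GE.
have froot x : laurent_root f x -> root (intpC g) x.
  move=> [x0]; under eq_bigr do rewrite mulrzl.
  rewrite (fg _ (fun k => x ^ k)).
  under eq_bigr do rewrite expfzDr // -mulrzAr.
  rewrite -mulr_sumr -gE rootE => /eqP; rewrite mulf_eq0.
  by rewrite (negPf (expfz_neq0 _ x0)).
have [[y [gy y1]]|small] := pselect (exists y, root (intpC g) y /\ 1 < `|y|); last first.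
  (* With no root outside the closed unit disc, the inverses of the roots lie in it too, so
     Kronecker's theorem applies. *)
  right=> x /froot gx.
  have [|n n0 xn] := @kronecker_unity_root g x gm _ gx; last first.
    by exists n; split=> //; rewrite unity_rootE xn.
  have le1 z : root (intpC g) z -> `|z| <= 1.
    move=> gz; rewrite real_leNgt ?normr_real //; apply/negP => z1.
    by apply: small; exists z.
  move=> z gz; apply/eqP; rewrite eq_le le1 //=.
  have := le1 _ (root_inv z gz).
  by rewrite normfV invf_le1 // normr_gt0 root_neq0.
left; have [alpha ga gmax] :
    exists2 alpha, alpha \in G & {in G, forall z, `|z| <= `|alpha|}.
  move: gy; rewrite GE root_prod_XsubC.
  elim: (G) y {y1} => // z s IH y _; case: s IH => [|z' s] IH.
    by exists z; rewrite ?mem_head // => t; rewrite inE => /eqP->.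
  have [al als almax] := IH z' (mem_head _ _).
  have [le|le] := real_leP (normr_real z) (normr_real al).
    by exists al; [rewrite inE als orbT|move=> t; rewrite inE => /predU1P[->//|/almax]].
  exists z; first exact: mem_head.
  by move=> t; rewrite inE => /predU1P[->//|/almax/le_trans]; apply; apply: ltW.
have Groot z : root (intpC g) z = (z \in G) by rewrite GE root_prod_XsubC.
apply: (unit_eq_pm1_of_large_root (alpha := alpha) fg) => //; first by rewrite Groot.
  by apply: lt_le_trans y1 _; apply: gmax; rewrite -Groot.
by move=> z; rewrite Groot; apply: gmax.
Qed.
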